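(* Let $1\le p<\infty$, let $\omega=(\omega_k)_{k\in\mathbb N}$ be a sequence of positive real numbers with $\sup_{k\in\mathbb N}\omega_k/\omega_{k+1}<\infty$, and let $B$ be the backward shift operator on $\ell^p(\mathbb N,\omega)$. For $r>0$ put $$a_r:=\sup_{N\ge1}\ \sup_{i\ge N}\ \frac1N\sum_{k=0}^{N-1}\Big(\frac{\omega_{i-k}}{\omega_i}\Big)^r\in[0,\infty].$$ Then: (1) If $q\ge p$ and $a_q<\infty$, then $B$ is $q$-absolutely Cesàro bounded. (2) Conversely, if $B$ is $r$-absolutely Cesàro bounded for some $r>0$, then $a_r<\infty$. In particular, (3) If $q\ge p$, then $B$ is $q$-absolutely Cesàro bounded if and only if $a_q<\infty$. Moreover, in that case, $C_{q,\mathrm{ac}}(B)=a_q$.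
   Context: $\mathbb N=\{1,2,\dots\}$ and $\mathbb K$ is $\mathbb R$ or $\mathbb C$. The weighted space is $\ell^p(\mathbb N,\omega)=\{(x_k)_{k\in\mathbb N}\in\mathbb K^{\mathbb N}:\sum_{k\ge1}|x_k|^p\omega_k^p<\infty\}$ with norm $\|x\|_{p,\omega}=(\sum_{k\ge1}|x_k|^p\omega_k^p)^{1/p}$. The backward shift is $B((x_k)_{k\in\mathbb N})=(x_{k+1})_{k\in\mathbb N}$; it is bounded because $\sup_k\omega_k/\omega_{k+1}<\infty$. A bounded operator $T$ on a Banach space $X$ is $r$-absolutely Cesàro bounded ($r>0$) if there is $C>0$ with $\sup_{n\ge1}\frac1n\sum_{k=0}^{n-1}\|T^kx\|^r\le C\|x\|^r$ for all $x\in X$; $C_{r,\mathrm{ac}}(T)$ is the smallest such constant. *)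

(* Defs.v *)
From Stdlib Require Import Reals Lra Lia FunctionalExtensionality ProofIrrelevance.
From Coquelicot Require Import Coquelicot.
Open Scope R_scope.

(** Sequences indexed by {1,2,...} are encoded as functions on [nat]: the value
    at [k : nat] is the entry of index [k+1]. *)

(** Real power of a nonnegative base with positive exponent.  Stdlib's [Rpower]
    is not suitable as it stands because [Rpower 0 r = 1]. *)
Definition rpow (x r : R) : R :=
  if Rlt_dec 0 x then Rpower x r else 0.

Lemma rpow_pos x r : 0 < x -> rpow x r = Rpower x r.
Proof. intros Hx; unfold rpow; destruct (Rlt_dec 0 x); [reflexivity|lra]. Qed.

Lemma rpow_npos x r : x <= 0 -> rpow x r = 0.
Proof. intros Hx; unfold rpow; destruct (Rlt_dec 0 x); [lra|reflexivity]. Qed.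

Lemma rpow_gt0 x r : 0 < x -> 0 < rpow x r.
Proof. intros Hx; rewrite rpow_pos by assumption; apply exp_pos. Qed.

Lemma rpow_ge0 x r : 0 <= rpow x r.
Proof.
destruct (Rlt_dec 0 x) as [Hx|Hx]; [left; now apply rpow_gt0|].
rewrite rpow_npos; lra.
Qed.

Lemma rpow_eq0 x r : 0 <= x -> rpow x r = 0 -> x = 0.
Proof. intros Hx H0; destruct Hx as [Hx|]; [|easy]; pose proof (rpow_gt0 x r Hx); lra. Qed.

Lemma rpow_mult x y r : 0 <= x -> 0 <= y -> rpow (x * y) r = rpow x r * rpow y r.
Proof.
intros [Hx|<-] [Hy|<-]; rewrite ?Rmult_0_l, ?Rmult_0_r, ?(rpow_npos 0) by lra; try ring.
rewrite !rpow_pos by (try apply Rmult_lt_0_compat; assumption).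
symmetry; now apply Rpower_mult_distr.
Qed.

Lemma rpow_le x y r : 0 < r -> x <= y -> rpow x r <= rpow y r.
Proof.
intros Hr Hxy; destruct (Rlt_dec 0 x) as [Hx|Hx].
- rewrite !rpow_pos by lra; apply Rle_Rpower_l; lra.
- rewrite (rpow_npos x) by lra; apply rpow_ge0.
Qed.

Lemma rpow_rpow x r s : rpow (rpow x r) s = rpow x (r * s).
Proof.
destruct (Rlt_dec 0 x) as [Hx|Hx].
- rewrite (rpow_pos (rpow x r)) by now apply rpow_gt0.
  rewrite !rpow_pos by assumption; apply Rpower_mult.
- rewrite !(rpow_npos x) by lra; apply rpow_npos; lra.
Qed.

Lemma rpow_1 x : 0 <= x -> rpow x 1 = x.
Proof.
intros [Hx|<-]; [rewrite rpow_pos by assumption; now apply Rpower_1|].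
apply rpow_npos; lra.
Qed.

Lemma exp_convex t y : 0 <= t <= 1 -> exp (t * y) <= t * exp y + (1 - t).
Proof.
intros Ht; set (c := t * y).
assert (Hc : 0 < exp c) by apply exp_pos.
assert (tangent : forall z, exp c * (1 + (z - c)) <= exp z).
{ intros z; replace (exp z) with (exp c * exp (z - c))
    by (rewrite <- exp_plus; f_equal; ring).
  apply Rmult_le_compat_l; [lra|apply exp_ineq1_le]. }
pose proof (tangent y) as H1; pose proof (tangent 0) as H2.
rewrite exp_0 in H2.
apply Rle_trans with (t * (exp c * (1 + (y - c))) + (1 - t) * (exp c * (1 + (0 - c)))).
- right; unfold c; ring.
- replace (1 - t) with ((1 - t) * 1) at 2 by ring.
  apply Rplus_le_compat; apply Rmult_le_compat_l; lra.
Qed.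

Lemma rpow_bernoulli s p : 1 <= p -> 0 <= s -> 1 + p * (s - 1) <= rpow s p.
Proof.
intros Hp [Hs|<-]; [|rewrite rpow_npos; lra].
rewrite rpow_pos by assumption; unfold Rpower.
assert (Hi : 0 <= / p <= 1).
{ split; [left; apply Rinv_0_lt_compat; lra|].
  rewrite <- Rinv_1; apply Rinv_le_contravar; lra. }
pose proof (exp_convex (/ p) (p * ln s) Hi) as H.
replace (/ p * (p * ln s)) with (ln s) in H by (field; lra).
rewrite exp_ln in H by assumption.
apply Rmult_le_compat_l with (r := p) in H; [|lra].
replace (p * (/ p * exp (p * ln s) + (1 - / p)))
  with (exp (p * ln s) + (p - 1)) in H by (field; lra).
lra.
Qed.

Lemma rpow_convex p t a b : 1 <= p -> 0 <= t <= 1 -> 0 <= a -> 0 <= b ->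
  rpow (t * a + (1 - t) * b) p <= t * rpow a p + (1 - t) * rpow b p.
Proof.
intros Hp Ht Ha Hb; set (m := t * a + (1 - t) * b).
assert (Hta : 0 <= t * a) by (apply Rmult_le_pos; lra).
assert (Htb : 0 <= (1 - t) * b) by (apply Rmult_le_pos; lra).
assert (Hm0 : 0 <= m) by (unfold m; lra).
destruct Hm0 as [Hm|Hm].
2:{ rewrite <- Hm, rpow_npos by lra.
    pose proof (rpow_ge0 a p); pose proof (rpow_ge0 b p).
    apply Rplus_le_le_0_compat; apply Rmult_le_pos; lra. }
assert (tangent : forall z, 0 <= z ->
  rpow m p * (1 + p * (z / m - 1)) <= rpow z p).
{ intros z Hz.
  assert (Hq : 0 <= z / m) by (apply Rdiv_le_0_compat; assumption).
  replace (rpow z p) with (rpow m p * rpow (z / m) p).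
  - apply Rmult_le_compat_l; [apply rpow_ge0|now apply rpow_bernoulli].
  - rewrite <- rpow_mult by lra; f_equal; field; lra. }
apply Rle_trans with (t * (rpow m p * (1 + p * (a / m - 1)))
  + (1 - t) * (rpow m p * (1 + p * (b / m - 1)))).
- right; replace (t * (rpow m p * (1 + p * (a / m - 1)))
    + (1 - t) * (rpow m p * (1 + p * (b / m - 1))))
    with (rpow m p * (1 + p * ((t * a + (1 - t) * b) / m - 1))) by (field; lra).
  fold m; field; lra.
- apply Rplus_le_compat; apply Rmult_le_compat_l; try apply tangent; lra.
Qed.

Lemma ex_series_le_pos (a b : nat -> R) :
  (forall n, 0 <= a n <= b n) -> ex_series b -> ex_series a.
Proof.
intros H; apply (@ex_series_le R_AbsRing R_CompleteNormedModule).
intros n; change (Rabs (a n) <= b n); rewrite Rabs_pos_eq; apply H.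
Qed.

Lemma Series_ge0 (a : nat -> R) : (forall n, 0 <= a n) -> ex_series a -> 0 <= Series a.
Proof.
intros H Ha.
replace 0 with (Series (fun n => 0 * a n)) by (rewrite Series_scal_l; ring).
apply Series_le; [|assumption].
intros n; specialize (H n); rewrite Rmult_0_l; lra.
Qed.

Lemma Series_term_le (a : nat -> R) :
  (forall n, 0 <= a n) -> ex_series a -> forall k, a k <= Series a.
Proof.
intros H Ha k.
assert (Hk : ex_series (fun j => a (S k + j)%nat)).
{ now apply (ex_series_incr_n a (S k)). }
rewrite (Series_incr_n a (S k)) by (try lia; assumption); simpl pred.
assert (H1 : a k <= sum_f_R0 a k).
{ destruct k; simpl; [lra|].
  pose proof (cond_pos_sum a k H); lra. }
assert (0 <= Series (fun j => a (S k + j)%nat)) by (apply Series_ge0; auto).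
lra.
Qed.

Section Minkowski.

Variable p : R.
Hypothesis hp : 1 <= p.

Let psum (u : nat -> R) : R := Series (fun k => rpow (u k) p).
Let psummable (u : nat -> R) : Prop := ex_series (fun k => rpow (u k) p).

Lemma ex_pseries_plus (u v : nat -> R) :
  (forall k, 0 <= u k) -> (forall k, 0 <= v k) ->
  psummable u -> psummable v -> psummable (fun k => u k + v k).
Proof.
intros Hu Hv Su Sv; unfold psummable.
apply ex_series_le_pos with (fun k =>
  rpow 2 p * / 2 * rpow (u k) p + rpow 2 p * / 2 * rpow (v k) p).
- intros k; split; [apply rpow_ge0|].
  replace (u k + v k) with (2 * (/ 2 * u k + (1 - / 2) * v k)) by field.
  specialize (Hu k); specialize (Hv k).
  rewrite rpow_mult by lra.
  pose proof (rpow_convex p (/ 2) (u k) (v k) hp ltac:(lra) Hu Hv) as H.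
  apply Rmult_le_compat_l with (r := rpow 2 p) in H; [|apply rpow_ge0].
  lra.
- apply (@ex_series_plus R_AbsRing R_NormedModule);
    now apply (@ex_series_scal_l R_AbsRing).
Qed.

Lemma psum_ge0 u : psummable u -> 0 <= psum u.
Proof. intros Su; apply Series_ge0; [intros; apply rpow_ge0|exact Su]. Qed.

Lemma psum_root u : psummable u -> rpow (rpow (psum u) (/ p)) p = psum u.
Proof.
intros Su; rewrite rpow_rpow, Rinv_l, rpow_1; [reflexivity|now apply psum_ge0|lra].
Qed.

Lemma psum_eq0 u : (forall k, 0 <= u k) -> psummable u ->
  rpow (psum u) (/ p) = 0 -> forall k, u k = 0.
Proof.
intros Hu Su H k.
apply (rpow_eq0 _ p); [apply Hu|].
assert (H0 : psum u = 0) by (apply (rpow_eq0 _ (/ p)); [now apply psum_ge0|exact H]).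
pose proof (Series_term_le (fun k => rpow (u k) p) (fun n => rpow_ge0 _ _) Su k) as Hk.
fold (psum u) in Hk; simpl in Hk.
pose proof (rpow_ge0 (u k) p); lra.
Qed.

Lemma minkowski (u v : nat -> R) :
  (forall k, 0 <= u k) -> (forall k, 0 <= v k) -> psummable u -> psummable v ->
  rpow (psum (fun k => u k + v k)) (/ p) <= rpow (psum u) (/ p) + rpow (psum v) (/ p).
Proof.
intros Hu Hv Su Sv.
pose proof (psum_root u Su) as HA; pose proof (psum_root v Sv) as HB.
pose proof (psum_eq0 u Hu Su) as ZA; pose proof (psum_eq0 v Hv Sv) as ZB.
assert (PA : 0 <= rpow (psum u) (/ p)) by apply rpow_ge0.
assert (PB : 0 <= rpow (psum v) (/ p)) by apply rpow_ge0.
set (A := rpow (psum u) (/ p)) in *; set (B := rpow (psum v) (/ p)) in *.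
destruct PA as [PA|PA].
2:{ rewrite <- PA, Rplus_0_l; right; unfold B; do 2 f_equal.
    apply functional_extensionality; intros k; rewrite ZA by easy; ring. }
destruct PB as [PB|PB].
2:{ rewrite <- PB, Rplus_0_r; right; unfold A; do 2 f_equal.
    apply functional_extensionality; intros k; rewrite (ZB (eq_sym PB)); ring. }
assert (Hip : 0 < / p) by (apply Rinv_0_lt_compat; lra).
replace (A + B) with (rpow (rpow (A + B) p) (/ p))
  by (rewrite rpow_rpow, Rinv_r, rpow_1; lra).
apply rpow_le; [assumption|].
set (c := rpow (A + B) p).
set (t := A / (A + B)).
assert (Ht : 0 <= t <= 1).
{ unfold t; split; [apply Rdiv_le_0_compat; lra|].
  apply Rmult_le_reg_r with (A + B); [lra|].
  unfold Rdiv; rewrite Rmult_assoc, Rinv_l; lra. }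
assert (scaled : forall (f : nat -> R) D, 0 < D -> (forall k, 0 <= f k) ->
  rpow D p = psum f -> forall k, rpow (f k / D) p = rpow (f k) p * / psum f).
{ intros f D HD Hf E k.
  assert (0 < psum f) by (rewrite <- E; now apply rpow_gt0).
  apply Rmult_eq_reg_r with (rpow D p); [|rewrite E; lra].
  assert (0 <= f k / D) by (apply Rdiv_le_0_compat; auto).
  rewrite <- rpow_mult by lra.
  replace (f k / D * D) with (f k) by (field; lra).
  rewrite E; field; lra. }
assert (PU : 0 < psum u) by (rewrite <- HA; now apply rpow_gt0).
assert (PV : 0 < psum v) by (rewrite <- HB; now apply rpow_gt0).
apply Rle_trans with (Series (fun k =>
  c * t * / psum u * rpow (u k) p + c * (1 - t) * / psum v * rpow (v k) p)).
- apply Series_le.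
  + intros k; split; [apply rpow_ge0|].
    specialize (scaled u A PA Hu HA k) as E1.
    specialize (scaled v B PB Hv HB k) as E2.
    assert (Q1 : 0 <= u k / A) by (apply Rdiv_le_0_compat; auto).
    assert (Q2 : 0 <= v k / B) by (apply Rdiv_le_0_compat; auto).
    pose proof (rpow_convex p t _ _ hp Ht Q1 Q2) as H.
    rewrite E1, E2 in H.
    apply Rmult_le_compat_l with (r := c) in H; [|apply rpow_ge0].
    unfold c in H at 1; rewrite <- rpow_mult in H; try lra.
    2:{ apply Rplus_le_le_0_compat; apply Rmult_le_pos; lra. }
    replace ((A + B) * (t * (u k / A) + (1 - t) * (v k / B))) with (u k + v k) in H
      by (unfold t; field; lra).
    lra.
  + apply (@ex_series_plus R_AbsRing R_NormedModule);
      now apply (@ex_series_scal_l R_AbsRing).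
- rewrite Series_plus by now apply (@ex_series_scal_l R_AbsRing).
  rewrite !Series_scal_l; fold (psum u) (psum v).
  right; field; lra.
Qed.

End Minkowski.

Lemma opp_sub {G : AbelianGroup} (a b : G) : opp (plus a (opp b)) = plus b (opp a).
Proof. now rewrite opp_plus, opp_opp, plus_comm. Qed.

Lemma sub_chasles {G : AbelianGroup} (a b c : G) :
  plus (plus a (opp b)) (plus b (opp c)) = plus a (opp c).
Proof. now rewrite <- plus_assoc, (plus_assoc (opp b)), plus_opp_l, plus_zero_l. Qed.

Section WeightedLp.

Context {K : AbsRing}.

Definition lp_terms (p : R) (w : nat -> R) (x : nat -> K) : nat -> R :=
  fun k => rpow (abs (x k)) p * rpow (w k) p.

Definition in_lp (p : R) (w : nat -> R) (x : nat -> K) : Prop :=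
  ex_series (lp_terms p w x).

Definition wlp (p : R) (w : nat -> R) : Type :=
  { x : nat -> K | in_lp p w x }.

Definition seq_of {p w} (x : wlp p w) : nat -> K := proj1_sig x.

Definition lp_norm {p w} (x : wlp p w) : R :=
  rpow (Series (lp_terms p w (seq_of x))) (/ p).

Variables (p : R) (hp : 1 <= p) (w : nat -> R) (hw : forall k, 0 < w k).

Lemma wlp_eq (x y : wlp p w) : (forall k, seq_of x k = seq_of y k) -> x = y.
Proof.
destruct x as [x Hx], y as [y Hy]; unfold seq_of; simpl; intros H.
assert (E : x = y) by now apply functional_extensionality.
subst y; f_equal; apply proof_irrelevance.
Qed.

Lemma lp_termsE (x : nat -> K) :
  lp_terms p w x = (fun k => rpow (abs (x k) * w k) p).
Proof.
apply functional_extensionality; intros k; unfold lp_terms.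
rewrite rpow_mult; [reflexivity|apply abs_ge_0|left; apply hw].
Qed.

Lemma absw_ge0 (x : nat -> K) k : 0 <= abs (x k) * w k.
Proof. apply Rmult_le_pos; [apply abs_ge_0|left; apply hw]. Qed.

Lemma ex_lp_plus (x y : nat -> K) :
  ex_series (lp_terms p w x) -> ex_series (lp_terms p w y) ->
  ex_series (lp_terms p w (fun k => plus (x k) (y k))).
Proof.
rewrite !lp_termsE; intros Hx Hy.
apply ex_series_le_pos with
  (fun k => rpow (abs (x k) * w k + abs (y k) * w k) p).
- intros k; split; [apply rpow_ge0|].
  apply rpow_le; [lra|]; rewrite <- Rmult_plus_distr_r.
  apply Rmult_le_compat_r; [left; apply hw|apply abs_triangle].
- apply (ex_pseries_plus p hp (fun k => abs (x k) * w k) (fun k => abs (y k) * w k));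
    auto using absw_ge0.
Qed.

Lemma lp_terms_scal_le (l : K) (x : nat -> K) k :
  0 <= lp_terms p w (fun j => mult l (x j)) k <= rpow (abs l) p * lp_terms p w x k.
Proof.
unfold lp_terms; split; [apply Rmult_le_pos; apply rpow_ge0|].
rewrite <- Rmult_assoc, <- (rpow_mult (abs l) (abs (x k))) by apply abs_ge_0.
apply Rmult_le_compat_r; [apply rpow_ge0|].
apply rpow_le; [lra|apply abs_mult].
Qed.

Lemma ex_lp_scal (l : K) (x : nat -> K) :
  ex_series (lp_terms p w x) -> ex_series (lp_terms p w (fun k => mult l (x k))).
Proof.
intros Hx; eapply ex_series_le_pos; [apply lp_terms_scal_le|].
now apply (@ex_series_scal_l R_AbsRing).
Qed.

Lemma lp_terms_opp (x : nat -> K) : lp_terms p w (fun k => opp (x k)) = lp_terms p w x.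
Proof.
apply functional_extensionality; intros k; unfold lp_terms; now rewrite abs_opp.
Qed.

Lemma ex_lp_opp (x : nat -> K) :
  ex_series (lp_terms p w x) -> ex_series (lp_terms p w (fun k => opp (x k))).
Proof. now rewrite lp_terms_opp. Qed.

Lemma lp_terms_zero : lp_terms p w (fun _ => zero) = (fun _ => 0).
Proof.
apply functional_extensionality; intros k; unfold lp_terms.
rewrite abs_zero, (rpow_npos 0) by lra; ring.
Qed.

Lemma ex_lp_zero : ex_series (lp_terms p w (fun _ => zero)).
Proof.
rewrite lp_terms_zero; exists 0.
apply (is_series_ext (fun k => (fun _ : nat => 0) k)); [easy|].
apply filterlim_ext with (fun _ : nat => 0); [|apply filterlim_const].
intros n; rewrite sum_n_const; ring.
Qed.

Definition wlp_plus (x y : wlp p w) : wlp p w :=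
  exist (in_lp p w) _ (ex_lp_plus _ _ (proj2_sig x) (proj2_sig y)).
Definition wlp_opp (x : wlp p w) : wlp p w := exist (in_lp p w) _ (ex_lp_opp _ (proj2_sig x)).
Definition wlp_zero : wlp p w := exist (in_lp p w) _ ex_lp_zero.
Definition wlp_scal (l : K) (x : wlp p w) : wlp p w :=
  exist (in_lp p w) _ (ex_lp_scal l _ (proj2_sig x)).

Definition wlp_AbelianMonoid_mixin : AbelianMonoid.mixin_of (wlp p w).
Proof.
apply (AbelianMonoid.Mixin _ wlp_plus wlp_zero); intros; apply wlp_eq; intros k.
- apply plus_comm.
- apply plus_assoc.
- apply plus_zero_r.
Defined.

Definition wlp_AbelianGroup_mixin :
  AbelianGroup.mixin_of (AbelianMonoid.Pack _ wlp_AbelianMonoid_mixin (wlp p w)).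
Proof.
apply (AbelianGroup.Mixin (AbelianMonoid.Pack _ wlp_AbelianMonoid_mixin (wlp p w))
  wlp_opp); intros x; apply wlp_eq; intros k; exact (plus_opp_r (seq_of x k)).
Defined.

Definition wlp_AbelianGroup : AbelianGroup :=
  AbelianGroup.Pack _ (AbelianGroup.Class _ _ wlp_AbelianGroup_mixin) (wlp p w).

Definition wlp_ModuleSpace_mixin : ModuleSpace.mixin_of K wlp_AbelianGroup.
Proof.
apply (ModuleSpace.Mixin K wlp_AbelianGroup wlp_scal); intros; apply wlp_eq; intros k.
- apply mult_assoc.
- apply mult_one_l.
- exact (mult_distr_l x (seq_of u k) (seq_of v k)).
- exact (mult_distr_r x y (seq_of u k)).
Defined.

Lemma lp_norm_triangle (x y : wlp p w) :
  lp_norm (wlp_plus x y) <= lp_norm x + lp_norm y.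
Proof.
destruct x as [x Hx], y as [y Hy]; unfold lp_norm, wlp_plus, seq_of; simpl.
unfold in_lp in *; rewrite lp_termsE in Hx, Hy.
assert (Hip : 0 < / p) by (apply Rinv_0_lt_compat; lra).
eapply Rle_trans; [|rewrite !lp_termsE;
  apply (minkowski p hp (fun k => abs (x k) * w k) (fun k => abs (y k) * w k));
  auto using absw_ge0].
apply rpow_le; [assumption|rewrite lp_termsE; apply Series_le].
- intros k; split; [apply rpow_ge0|].
  apply rpow_le; [lra|]; rewrite <- Rmult_plus_distr_r.
  apply Rmult_le_compat_r; [left; apply hw|apply abs_triangle].
- apply (ex_pseries_plus p hp (fun k => abs (x k) * w k) (fun k => abs (y k) * w k));
    auto using absw_ge0.
Qed.

Lemma lp_norm_scal (l : K) (x : wlp p w) :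
  lp_norm (wlp_scal l x) <= abs l * lp_norm x.
Proof.
destruct x as [x Hx]; unfold lp_norm, wlp_scal, seq_of; simpl.
assert (Hip : 0 < / p) by (apply Rinv_0_lt_compat; lra).
replace (abs l) with (rpow (rpow (abs l) p) (/ p))
  by (rewrite rpow_rpow, Rinv_r, rpow_1; [reflexivity|apply abs_ge_0|lra]).
rewrite <- rpow_mult, <- Series_scal_l; [|apply rpow_ge0|].
- apply rpow_le; [assumption|]; apply Series_le; [apply lp_terms_scal_le|].
  now apply (@ex_series_scal_l R_AbsRing).
- apply Series_ge0; [|assumption].
  intros k; apply Rmult_le_pos; apply rpow_ge0.
Qed.

Lemma lp_norm_opp (x : wlp p w) : lp_norm (wlp_opp x) = lp_norm x.
Proof.
destruct x as [x Hx]; unfold lp_norm, wlp_opp, seq_of; simpl.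
now rewrite lp_terms_opp.
Qed.

Lemma lp_norm_zero : lp_norm wlp_zero = 0.
Proof.
unfold lp_norm, wlp_zero, seq_of; simpl; rewrite lp_terms_zero.
apply rpow_npos; right.
transitivity (Series (fun _ : nat => 0 * 0)); [apply Series_ext; intros; ring|].
rewrite Series_scal_l; ring.
Qed.

Lemma lp_norm_eq0 (x : wlp p w) : lp_norm x = 0 -> x = wlp_zero.
Proof.
intros H; apply wlp_eq; intros k; apply abs_eq_zero.
destruct x as [x Hx]; unfold lp_norm, seq_of in *; simpl in *.
unfold in_lp in *; rewrite lp_termsE in H, Hx.
pose proof (psum_eq0 p (fun k => abs (x k) * w k) (absw_ge0 x) Hx H k) as E.
simpl in E; pose proof (hw k).
apply Rmult_integral in E; destruct E; [assumption|lra].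
Qed.

Definition wlp_ball (x : wlp p w) (eps : R) (y : wlp p w) : Prop :=
  lp_norm (wlp_plus y (wlp_opp x)) < eps.

Definition wlp_UniformSpace_mixin : UniformSpace.mixin_of (wlp p w).
Proof.
apply (UniformSpace.Mixin _ wlp_zero wlp_ball); unfold wlp_ball.
- intros x e; replace (wlp_plus x (wlp_opp x)) with wlp_zero.
  + rewrite lp_norm_zero; apply cond_pos.
  + apply wlp_eq; intros k; symmetry; exact (plus_opp_r (seq_of x k)).
- intros x y e; rewrite <- lp_norm_opp.
  replace (wlp_opp (wlp_plus y (wlp_opp x))) with (wlp_plus x (wlp_opp y)); [easy|].
  apply wlp_eq; intros k; symmetry.
  exact (opp_sub (seq_of y k) (seq_of x k)).
- intros x y z e1 e2 H1 H2.
  replace (wlp_plus z (wlp_opp x))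
    with (wlp_plus (wlp_plus z (wlp_opp y)) (wlp_plus y (wlp_opp x))).
  + eapply Rle_lt_trans; [apply lp_norm_triangle|lra].
  + apply wlp_eq; intros k.
    exact (sub_chasles (seq_of z k) (seq_of y k) (seq_of x k)).
Defined.

Definition wlp_NormedModuleAux_class : NormedModuleAux.class_of K (wlp p w) :=
  NormedModuleAux.Class K _
    (ModuleSpace.Class K _ (AbelianGroup.class wlp_AbelianGroup) wlp_ModuleSpace_mixin)
    wlp_UniformSpace_mixin.

Definition wlp_NormedModule_mixin :
  NormedModule.mixin_of K (NormedModuleAux.Pack K _ wlp_NormedModuleAux_class (wlp p w)).
Proof.
apply (NormedModule.Mixin K
  (NormedModuleAux.Pack K _ wlp_NormedModuleAux_class (wlp p w)) lp_norm 1).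
- exact lp_norm_triangle.
- exact lp_norm_scal.
- intros x y eps H; exact H.
- intros x y eps H; rewrite Rmult_1_l; exact H.
- exact lp_norm_eq0.
Defined.

Definition weighted_lp : NormedModule K :=
  NormedModule.Pack K _ (NormedModule.Class K _ _ wlp_NormedModule_mixin) (wlp p w).

Variable hb : Rbar_lt (Sup_seq (fun k => Finite (w k / w (S k)))) p_infty.

Lemma weight_ratio_bound : exists M, 0 < M /\ forall k, w k <= M * w (S k).
Proof.
assert (H : exists M, forall k, w k / w (S k) <= M).
{ pose proof (fun k => Sup_seq_minor_le (fun k => Finite (w k / w (S k)))
    (w k / w (S k)) k (Rle_refl _)) as Hk.
  destruct (Sup_seq (fun k => Finite (w k / w (S k)))) as [M| |].
  - exists M; exact Hk.
  - destruct hb.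
  - destruct (Hk O). }
destruct H as [M HM]; exists M; split.
- apply Rlt_le_trans with (2 := HM O).
  apply Rdiv_lt_0_compat; apply hw.
- intros k; specialize (HM k); pose proof (hw (S k)).
  apply Rmult_le_compat_r with (r := w (S k)) in HM; [|lra].
  replace (w k / w (S k) * w (S k)) with (w k) in HM by (field; lra); exact HM.
Qed.

Lemma lp_terms_shift_le : exists M, 0 < M /\ forall (x : nat -> K) k,
  0 <= lp_terms p w (fun j => x (S j)) k <= rpow M p * lp_terms p w x (S k).
Proof.
destruct weight_ratio_bound as [M [HM Hw]]; exists M; split; [assumption|].
intros x k; unfold lp_terms; split; [apply Rmult_le_pos; apply rpow_ge0|].
rewrite (Rmult_comm (rpow M p)), Rmult_assoc.
apply Rmult_le_compat_l; [apply rpow_ge0|].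
rewrite (Rmult_comm _ (rpow M p)), <- rpow_mult by (pose proof (hw (S k)); lra).
apply rpow_le; [lra|apply Hw].
Qed.

Lemma ex_lp_shift (x : nat -> K) :
  ex_series (lp_terms p w x) -> ex_series (lp_terms p w (fun k => x (S k))).
Proof.
intros Hx; destruct lp_terms_shift_le as [M [HM H]].
eapply ex_series_le_pos; [apply H|].
apply (@ex_series_scal_l R_AbsRing).
now apply (ex_series_incr_1 (lp_terms p w x)).
Qed.

Definition backward_shift (x : weighted_lp) : weighted_lp :=
  exist (in_lp p w) (fun k => seq_of x (S k)) (ex_lp_shift _ (proj2_sig x)).

Lemma backward_shift_is_linear : is_linear backward_shift.
Proof.
split.
- intros x y; apply wlp_eq; reflexivity.
- intros l x; apply wlp_eq; reflexivity.
- destruct lp_terms_shift_le as [M [HM H]]; exists M; split; [assumption|].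
  intros x; change (lp_norm (backward_shift x) <= M * lp_norm x).
  destruct x as [x Hx]; unfold lp_norm, backward_shift, seq_of; simpl.
  assert (Hip : 0 < / p) by (apply Rinv_0_lt_compat; lra).
  assert (P : forall k, 0 <= lp_terms p w x k)
    by (intros k; apply Rmult_le_pos; apply rpow_ge0).
  replace M with (rpow (rpow M p) (/ p)) by (rewrite rpow_rpow, Rinv_r, rpow_1; lra).
  rewrite <- rpow_mult; [|apply rpow_ge0|now apply Series_ge0].
  apply rpow_le; [assumption|].
  apply Rle_trans with (rpow M p * Series (fun k => lp_terms p w x (S k))).
  + rewrite <- Series_scal_l; apply Series_le; [apply H|].
    apply (@ex_series_scal_l R_AbsRing).
    now apply (ex_series_incr_1 (lp_terms p w x)).
  + apply Rmult_le_compat_l; [apply rpow_ge0|].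
    rewrite (Series_incr_1 (lp_terms p w x)) by assumption.
    specialize (P O); lra.
Qed.

End WeightedLp.

Arguments weighted_lp K {p} hp {w} hw.
Arguments backward_shift K {p} hp {w} hw hb x.

(** Suprema over n >= 1 are written with [n+1], [n : nat];
    [sum_n f n] is f 0 + ... + f n, hence has n+1 terms. *)
Definition abs_cesaro_bound {K : AbsRing} {X : NormedModule K}
    (T : X -> X) (r C : R) : Prop :=
  0 < C /\
  forall x : X,
    Rbar_le
      (Sup_seq (fun n : nat =>
         Finite (/ INR (S n) * sum_n (fun k => rpow (norm (Nat.iter k T x)) r) n)))
      (Finite (C * rpow (norm x) r)).

(** [is_linear] is Coquelicot's notion of bounded linear operator. *)
Definition abs_cesaro_bounded {K : AbsRing} {X : NormedModule K}
    (T : X -> X) (r : R) : Prop :=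
  is_linear T /\ exists C : R, abs_cesaro_bound T r C.

Definition is_abs_cesaro_constant {K : AbsRing} {X : NormedModule K}
    (T : X -> X) (r C : R) : Prop :=
  abs_cesaro_bound T r C /\ forall C' : R, abs_cesaro_bound T r C' -> C <= C'.

(** With N = n+1 and i = N+j (so that i ranges over all i >= N), the weight of
    index i-k is [w (n + j - k)]; the subtraction is not truncated as k <= n. *)
Definition weight_cesaro_sup (w : nat -> R) (r : R) : Rbar :=
  Sup_seq (fun n : nat => Sup_seq (fun j : nat =>
    Finite (/ INR (S n) * sum_n (fun k => rpow (w (n + j - k)%nat / w (n + j)%nat) r) n))).

(* Main.v *)
Require Import Defs.
From Stdlib Require Import Reals Lra Lia PeanoNat.
From Coquelicot Require Import Coquelicot.
Open Scope R_scope.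

(** With indices from [0], write [c i = |x_i|^p w_i^p] and [v i k = w_(i-k) / w_i]
    ([0] for [k > i]), so that [|x|^p = sum_i c i] and [|B^k x|^p = sum_i c i * v i k ^ p].
    As [q / p >= 1], Jensen's inequality for the weights [c] gives
    [|B^k x|^q <= |x|^(q-p) * sum_i c i * v i k ^ q].  Averaging over [k < N] and exchanging
    the sums, it remains to bound the mean of [v i k ^ q] over [k < N] by [a_q]; for
    [i + 1 < N], where [a_q] does not see it directly, it is at most the mean over [k <= i].
    The unit vectors [e_i] give the reverse estimate for every exponent, since
    [B^k e_i = e_(i-k)]. *)

(** * Suprema, series and finite sums *)

Lemma Sup_seq_le_iff (u : nat -> Rbar) (M : Rbar) :
  Rbar_le (Sup_seq u) M <-> forall n, Rbar_le (u n) M.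
Proof.
destruct (is_sup_seq_lub _ _ (Sup_seq_correct u)) as [Hub Hlub]; split.
- intros H n; eapply Rbar_le_trans; [apply Hub; now exists n|exact H].
- intros H; apply Hlub; intros y [n ->]; apply H.
Qed.

Lemma is_series_zero_prefix (a : nat -> R) (k : nat) (l : R) :
  (forall i, (i < k)%nat -> a i = 0) ->
  is_series (fun j => a (k + j)%nat) l -> is_series a l.
Proof.
revert a; induction k as [|k IH]; intros a Ha H; [exact H|].
apply is_series_decr_1; rewrite (Ha O) by lia.
change opp with Ropp; change plus with Rplus; rewrite Ropp_0, Rplus_0_r.
apply IH; [intros i Hi; apply Ha; lia|exact H].
Qed.

Lemma is_series_zero : is_series (fun _ : nat => 0) 0.
Proof.
apply filterlim_ext with (fun _ : nat => 0); [|apply filterlim_const].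
intros n; rewrite sum_n_const; ring.
Qed.

Lemma is_series_single (i : nat) (l : R) :
  is_series (fun k => if Nat.eqb k i then l else 0) l.
Proof.
apply is_series_zero_prefix with i.
- intros k Hk; destruct (Nat.eqb_spec k i); [lia|reflexivity].
- apply is_series_decr_1; rewrite Nat.add_0_r, Nat.eqb_refl.
  change opp with Ropp; change plus with Rplus; rewrite Rplus_opp_r.
  apply (is_series_ext (fun _ : nat => 0)); [|exact is_series_zero].
  intros k; destruct (Nat.eqb_spec (i + S k) i); [lia|reflexivity].
Qed.

Lemma is_series_sum_n (f : nat -> nat -> R) (n : nat) :
  (forall k, (k <= n)%nat -> ex_series (f k)) ->
  is_series (fun i => sum_n (fun k => f k i) n) (sum_n (fun k => Series (f k)) n).
Proof.
induction n as [|n IH]; intros H.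
- rewrite sum_O; apply (is_series_ext (f O)); [intros i; now rewrite sum_O|].
  apply Series_correct, H; lia.
- rewrite sum_Sn.
  apply (is_series_ext (fun i => plus (sum_n (fun k => f k i) n) (f (S n) i))).
  + intros i; now rewrite sum_Sn.
  + apply (is_series_plus (K := R_AbsRing) (V := R_NormedModule));
      [apply IH; intros; apply H; lia|apply Series_correct, H; lia].
Qed.

Lemma sum_n_Rmult_l (c : R) (f : nat -> R) (n : nat) :
  sum_n (fun k => c * f k) n = c * sum_n f n.
Proof. exact (sum_n_mult_l (K := R_AbsRing) c f n). Qed.

Lemma sum_n_le_loc (f g : nat -> R) (n : nat) :
  (forall k, (k <= n)%nat -> f k <= g k) -> sum_n f n <= sum_n g n.
Proof.
induction n as [|n IH]; intros H; [rewrite !sum_O; apply H; lia|].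
rewrite !sum_Sn; apply Rplus_le_compat; [apply IH; intros; apply H|apply H]; lia.
Qed.

Lemma sum_n_term_le (f : nat -> R) (n k : nat) :
  (forall j, 0 <= f j) -> (k <= n)%nat -> f k <= sum_n f n.
Proof.
intros Hf; induction n as [|n IH]; intros Hk.
- replace k with O by lia; rewrite sum_O; apply Rle_refl.
- rewrite sum_Sn; change plus with Rplus; pose proof (Hf (S n)).
  assert (Hs : 0 <= sum_n f n).
  { rewrite sum_n_Reals; now apply cond_pos_sum. }
  destruct (Nat.eq_dec k (S n)) as [->|]; [lra|].
  specialize (IH ltac:(lia)); lra.
Qed.

Lemma sum_n_zero_tail (f : nat -> R) (m n : nat) :
  (m <= n)%nat -> (forall k, (m < k)%nat -> f k = 0) -> sum_n f n = sum_n f m.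
Proof.
intros Hmn Hf; induction Hmn as [|n Hmn IH]; [reflexivity|].
rewrite sum_Sn, IH, (Hf (S n)) by lia; apply Rplus_0_r.
Qed.

Lemma is_series_le (a b : nat -> R) (la lb : R) :
  (forall n, a n <= b n) -> is_series a la -> is_series b lb -> la <= lb.
Proof.
intros H Ha Hb.
apply (is_lim_seq_le (sum_n a) (sum_n b) la lb); [|exact Ha|exact Hb].
intros n; apply sum_n_le_loc; auto.
Qed.

Lemma mean_le_iff (n : nat) (s b : R) :
  / INR (S n) * s <= b <-> s <= INR (S n) * b.
Proof.
pose proof (lt_0_INR (S n) ltac:(lia)) as Hn; split; intros H.
- apply Rmult_le_compat_l with (r := INR (S n)) in H; [|lra].
  rewrite <- Rmult_assoc, Rinv_r, Rmult_1_l in H; lra.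
- apply Rmult_le_reg_l with (INR (S n)); [lra|].
  rewrite <- Rmult_assoc, Rinv_r, Rmult_1_l; lra.
Qed.

(** * Real powers and Jensen's inequality for series *)

Lemma rpow_base_1 (r : R) : rpow 1 r = 1.
Proof. rewrite rpow_pos by lra; unfold Rpower; now rewrite ln_1, Rmult_0_r, exp_0. Qed.

Lemma rpow_div (a b r : R) : 0 < a -> 0 < b -> rpow (a / b) r * rpow b r = rpow a r.
Proof.
intros Ha Hb; rewrite <- rpow_mult.
- f_equal; field; lra.
- apply Rdiv_le_0_compat; lra.
- lra.
Qed.

(** Jensen's inequality for the convex function t^s, obtained by summing its tangent at the mean of
    [u] with weights [c]. Clearing denominators avoids both division by [Series c] and the exponent
    [s - 1], so total mass 0 is allowed. *)
Lemma Series_jensen (s : R) (c u : nat -> R) :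
  1 <= s -> (forall i, 0 <= c i) -> (forall i, 0 <= u i) ->
  ex_series c -> ex_series (fun i => c i * u i) ->
  ex_series (fun i => c i * rpow (u i) s) ->
  Series c * rpow (Series (fun i => c i * u i)) s
    <= rpow (Series c) s * Series (fun i => c i * rpow (u i) s).
Proof.
intros Hs Hc Hu Ec Ecu Ecus.
assert (PS : 0 <= Series c) by now apply Series_ge0.
assert (PT : 0 <= Series (fun i => c i * rpow (u i) s)).
{ apply Series_ge0; [|assumption]; intros i; apply Rmult_le_pos; [easy|apply rpow_ge0]. }
assert (PU : 0 <= Series (fun i => c i * u i)).
{ apply Series_ge0; [|assumption]; intros i; now apply Rmult_le_pos. }
set (S := Series c) in *; set (U := Series (fun i => c i * u i)) in *.
set (T := Series (fun i => c i * rpow (u i) s)) in *.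
(* If [S] or [U] is 0, the left side is 0 and the right side is nonnegative. Otherwise the weighted
   mean [m] is positive. *)
destruct PS as [PS|<-];
  [|rewrite Rmult_0_l; apply Rmult_le_pos; [apply rpow_ge0|exact PT]].
destruct PU as [PU|<-]; [|rewrite (rpow_npos 0), Rmult_0_r by lra;
  apply Rmult_le_pos; [apply rpow_ge0|exact PT]].
set (m := U / S).
assert (Hm : 0 < m) by now apply Rdiv_lt_0_compat.
(* Bernoulli's inequality at [u i / m], scaled by [c i * rpow m s]: the graph of t^s lies above its
   tangent at [m]. *)
assert (tangent : forall i,
  rpow m s * (1 - s) * c i + rpow m s * s / m * (c i * u i) <= c i * rpow (u i) s).
{ intros i.
  assert (Hq : 0 <= u i / m) by (apply Rdiv_le_0_compat; auto).
  pose proof (rpow_bernoulli (u i / m) s Hs Hq) as H.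
  replace (rpow (u i) s) with (rpow m s * rpow (u i / m) s)
    by (rewrite <- rpow_mult by lra; f_equal; field; lra).
  apply Rmult_le_compat_l with (r := c i * rpow m s) in H.
  - replace (rpow m s * (1 - s) * c i + rpow m s * s / m * (c i * u i))
      with (c i * rpow m s * (1 + s * (u i / m - 1))) by (field; lra).
    lra.
  - apply Rmult_le_pos; [easy|apply rpow_ge0]. }
assert (main : S * rpow m s <= T).
{ assert (E : is_series (fun i => rpow m s * (1 - s) * c i + rpow m s * s / m * (c i * u i))
    (rpow m s * (1 - s) * S + rpow m s * s / m * U)).
  { apply (is_series_plus (K := R_AbsRing) (V := R_NormedModule));
      apply (is_series_scal (K := R_AbsRing) (V := R_NormedModule));
      now apply Series_correct. }
  (* After summation the contributions with factor [s] cancel, because [U = m * S]. *)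
  replace (S * rpow m s) with (rpow m s * (1 - s) * S + rpow m s * s / m * U)
    by (unfold m at 3; field; lra).
  exact (is_series_le _ _ _ _ tangent E (Series_correct _ Ecus)). }
replace U with (m * S) by (unfold m; field; lra).
rewrite rpow_mult by lra.
pose proof (Rmult_le_compat_l (rpow S s) _ _ (rpow_ge0 S s) main); lra.
Qed.

(** The value 0 for [k > i] encodes that [k] shifts discard the coordinate [i]; sums over [i] then
    need no lower limit depending on [k]. *)
Definition shift_ratio (w : nat -> R) (i k : nat) : R :=
  if Nat.leb k i then w (i - k)%nat / w i else 0.

(** * Averages of the weight ratios *)

Section Averages.

Context (w : nat -> R) (hw : forall k, 0 < w k).

(** With [N = n + 1] and indices from 0, the condition that the index is at least [N] becomes
    [n <= i]; the shift [j] of the definition is [i - n]. *)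
Lemma weight_cesaro_sup_le_iff (r a : R) :
  Rbar_le (weight_cesaro_sup w r) a <->
  forall n i, (n <= i)%nat ->
    sum_n (fun k => rpow (w (i - k)%nat / w i) r) n <= INR (S n) * a.
Proof.
unfold weight_cesaro_sup; rewrite Sup_seq_le_iff; split.
- intros H n i Hi; specialize (H n); rewrite Sup_seq_le_iff in H.
  specialize (H (i - n)%nat); apply (mean_le_iff n) in H.
  replace (n + (i - n))%nat with i in H by lia; exact H.
- intros H n; apply Sup_seq_le_iff; intros j; apply (mean_le_iff n).
  apply (H n (n + j)%nat); lia.
Qed.

Lemma sum_shift_ratio_le (q a : R) :
  Rbar_le (weight_cesaro_sup w q) a ->
  forall n i, sum_n (fun k => rpow (shift_ratio w i k) q) n <= INR (S n) * a.
Proof.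
intros H n i; rewrite weight_cesaro_sup_le_iff in H.
assert (Hin : forall m, (m <= i)%nat ->
  sum_n (fun k => rpow (shift_ratio w i k) q) m <= INR (S m) * a).
{ intros m Hm; rewrite <- (sum_n_ext_loc (fun k => rpow (w (i - k)%nat / w i) q));
    [now apply H|].
  intros k Hk; unfold shift_ratio; now rewrite (proj2 (Nat.leb_le k i)) by lia. }
destruct (Nat.le_gt_cases n i) as [Hni|Hni]; [now apply Hin|].
(* For [n > i] the sum stops at [k = i], where the bound is [INR (S i) * a]. Enlarging the factor to
   [INR (S n)] requires [0 <= a]. *)
rewrite (sum_n_zero_tail _ i n); [|lia|].
- specialize (Hin i (le_n i)).
  assert (Ha : 0 <= a).
  { pose proof (sum_n_term_le (fun k => rpow (shift_ratio w i k) q) i 0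
      (fun _ => rpow_ge0 _ _) ltac:(lia)) as H0; cbv beta in H0.
    pose proof (rpow_ge0 (shift_ratio w i 0) q).
    pose proof (lt_0_INR (S i) ltac:(lia)).
    apply Rmult_le_reg_l with (INR (S i)); lra. }
  eapply Rle_trans; [exact Hin|].
  apply Rmult_le_compat_r; [exact Ha|apply le_INR; lia].
- intros k Hk; unfold shift_ratio.
  rewrite (proj2 (Nat.leb_gt k i)) by lia; apply rpow_npos; lra.
Qed.

(** The average with [N = 1] is 1. This excludes [m_infty] and supplies the positivity demanded of a
    Cesàro constant. *)
Lemma weight_cesaro_sup_ge1 (r : R) : Rbar_le 1 (weight_cesaro_sup w r).
Proof.
destruct (weight_cesaro_sup w r) as [a| |] eqn:E; [|exact I|].
- pose proof (Rbar_le_refl a) as H; rewrite <- E in H at 1.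
  pose proof (proj1 (weight_cesaro_sup_le_iff r a) H O O (le_n 0)) as H0.
  rewrite sum_O, Rdiv_diag, rpow_base_1 in H0 by (pose proof (hw O); simpl; lra).
  simpl in *; lra.
(* A supremum [m_infty] would bound the nonnegative first term by -1. *)
- assert (H : forall a : R, Rbar_le (weight_cesaro_sup w r) a) by (rewrite E; easy).
  pose proof (proj1 (weight_cesaro_sup_le_iff r (-1)) (H (-1)) O O (le_n 0)) as H0.
  rewrite sum_O in H0; pose proof (rpow_ge0 (w (0 - 0)%nat / w 0%nat) r); simpl in *; lra.
Qed.

End Averages.

(** * Iterates of the shift and the upper estimate *)

Section Shift.

Context (K : AbsRing) (p : R) (hp : 1 <= p) (w : nat -> R) (hw : forall k, 0 < w k).
Context (hb : Rbar_lt (Sup_seq (fun k => Finite (w k / w (S k)))) p_infty).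

Let B : weighted_lp K hp hw -> weighted_lp K hp hw := backward_shift K hp hw hb.

Lemma seq_of_iter_shift (x : weighted_lp K hp hw) (k j : nat) :
  seq_of (Nat.iter k B x) j = seq_of x (k + j).
Proof.
revert j; induction k as [|k IH]; intros j; [reflexivity|].
simpl Nat.iter; change (seq_of (Nat.iter k B x) (S j) = seq_of x (S k + j)).
rewrite IH; f_equal; lia.
Qed.

Lemma lp_terms_ge0 (x : nat -> K) (i : nat) : 0 <= lp_terms p w x i.
Proof. apply Rmult_le_pos; apply rpow_ge0. Qed.

Lemma rpow_norm (x : weighted_lp K hp hw) (r : R) :
  rpow (norm x) r = rpow (Series (lp_terms p w (seq_of x))) (r / p).
Proof.
change (norm x) with (lp_norm x); unfold lp_norm; rewrite rpow_rpow; f_equal.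
unfold Rdiv; ring.
Qed.

(** Entry [j] of the iterate is entry [i = k + j] of [x], and replacing [w i] by [w j] costs the
    factor [w (i - k) / w i]. Indexing by [i] lets all iterates share the same Jensen weights. *)
Lemma is_series_iter_shift (x : weighted_lp K hp hw) (k : nat) :
  is_series (fun i => lp_terms p w (seq_of x) i * rpow (shift_ratio w i k) p)
    (Series (lp_terms p w (seq_of (Nat.iter k B x)))).
Proof.
apply is_series_zero_prefix with k.
- intros i Hi; unfold shift_ratio.
  rewrite (proj2 (Nat.leb_gt k i)), rpow_npos by (lra || lia); ring.
- apply (is_series_ext (lp_terms p w (seq_of (Nat.iter k B x)))).
  + intros j; unfold lp_terms, shift_ratio.
    rewrite (proj2 (Nat.leb_le k (k + j))), seq_of_iter_shift by lia.
    replace (k + j - k)%nat with j by lia.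
    rewrite Rmult_assoc, (Rmult_comm (rpow (w (k + j)%nat) p)), rpow_div; auto.
  + apply Series_correct; exact (proj2_sig (Nat.iter k B x)).
Qed.

(** The estimate is first proved multiplied by [Series c], the [p]-th power of the norm of [x], as
    Jensen's inequality provides it; the factor is then cancelled if positive. *)
Lemma shift_cesaro_le (q a : R) (x : weighted_lp K hp hw) (n : nat) :
  p <= q -> Rbar_le (weight_cesaro_sup w q) a ->
  sum_n (fun k => rpow (norm (Nat.iter k B x)) q) n <= INR (S n) * a * rpow (norm x) q.
Proof.
intros Hq Ha.
set (c := lp_terms p w (seq_of x)).
assert (Hc : forall i, 0 <= c i) by apply lp_terms_ge0.
assert (Ec : ex_series c) by exact (proj2_sig x).
pose proof (sum_shift_ratio_le w q a Ha n) as Hsum.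
set (M := INR (S n) * a) in *.
(* Each summand in [Hsum] is at most the whole sum, so [M * c i] dominates. *)
assert (Es : forall k, (k <= n)%nat ->
  ex_series (fun i => c i * rpow (shift_ratio w i k) q)).
{ intros k Hk; apply ex_series_le_pos with (fun i => M * c i).
  - intros i; split; [apply Rmult_le_pos; [easy|apply rpow_ge0]|].
    rewrite (Rmult_comm M); apply Rmult_le_compat_l; [easy|].
    eapply Rle_trans; [|apply (Hsum i)].
    apply (sum_n_term_le (fun k => rpow (shift_ratio w i k) q));
      [intros; apply rpow_ge0|exact Hk].
  - now apply (ex_series_scal (K := R_AbsRing) (V := R_NormedModule) M c). }
assert (Hs : 1 <= q / p).
{ apply Rmult_le_reg_r with p; [lra|]; unfold Rdiv.
  rewrite Rmult_assoc, Rinv_l; lra. }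
set (s := q / p) in *.
assert (Hps : p * s = q) by (unfold s; field; lra).
(* Jensen's inequality with exponent [s = q / p], applied to the [p]-th powers of the ratios, whose
   [s]-th powers are the [q]-th powers. *)
assert (jensen : forall k, (k <= n)%nat ->
  Series c * rpow (norm (Nat.iter k B x)) q
    <= rpow (norm x) q * Series (fun i => c i * rpow (shift_ratio w i k) q)).
{ intros k Hk; rewrite !rpow_norm; fold c s.
  rewrite <- (is_series_unique _ _ (is_series_iter_shift x k)); fold c.
  rewrite (Series_ext (fun i => c i * rpow (shift_ratio w i k) q)
    (fun i => c i * rpow (rpow (shift_ratio w i k) p) s))
    by (intros i; now rewrite rpow_rpow, Hps).
  apply Series_jensen; auto.
  - intros i; apply rpow_ge0.
  - eexists; apply is_series_iter_shift.
  - apply (ex_series_ext (fun i => c i * rpow (shift_ratio w i k) q)); [|auto].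
    intros i; now rewrite rpow_rpow, Hps. }
(* With the sum over [k] moved inside the series, [Hsum] bounds the coefficient of each [c i] by
   [M]. *)
assert (exchange : sum_n (fun k => Series (fun i => c i * rpow (shift_ratio w i k) q)) n
  <= M * Series c).
{ apply (is_series_le
    (fun i => sum_n (fun k => c i * rpow (shift_ratio w i k) q) n) (fun i => M * c i)).
  - intros i; rewrite sum_n_Rmult_l, (Rmult_comm M); apply Rmult_le_compat_l; [easy|apply Hsum].
  - now apply (is_series_sum_n (fun k i => c i * rpow (shift_ratio w i k) q)).
  - apply (is_series_scal (K := R_AbsRing) (V := R_NormedModule)).
    now apply Series_correct. }
assert (total : Series c * sum_n (fun k => rpow (norm (Nat.iter k B x)) q) n
  <= Series c * (M * rpow (norm x) q)).
{ apply Rle_trans with (rpow (norm x) q * (M * Series c)); [|right; ring].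
  eapply Rle_trans; [|apply Rmult_le_compat_l; [apply rpow_ge0|exact exchange]].
  rewrite <- !sum_n_Rmult_l.
  apply sum_n_le_loc; exact jensen. }
assert (PS : 0 <= Series c) by now apply Series_ge0.
destruct PS as [PS|PS]; [now apply Rmult_le_reg_l with (Series c)|].
(* If [Series c = 0], then [x = 0] and every iterate vanishes. *)
assert (Z : forall i, c i = 0).
{ intros i; apply Rle_antisym; [rewrite PS; now apply Series_term_le|apply Hc]. }
assert (ZB : forall k, rpow (norm (Nat.iter k B x)) q = 0).
{ intros k; rewrite rpow_norm, <- (is_series_unique _ _ (is_series_iter_shift x k)).
  fold c; rewrite (Series_ext _ (fun _ => 0)) by (intros i; rewrite Z; ring).
  rewrite (is_series_unique _ _ is_series_zero); apply rpow_npos; lra. }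
rewrite (sum_n_ext _ (fun _ => 0)) by exact ZB.
(* The iterate of order 0 is [x] itself, so the right side vanishes too. *)
rewrite (ZB O : rpow (norm x) q = 0), sum_n_const; lra.
Qed.

(** * Unit vectors and their orbits *)

Definition unit_seq (i : nat) : nat -> K := fun k => if Nat.eqb k i then one else zero.

Lemma is_series_unit_seq (i : nat) :
  is_series (lp_terms p w (unit_seq i)) (rpow (w i) p).
Proof.
apply (is_series_ext (fun k => if Nat.eqb k i then rpow (w i) p else 0));
  [|apply is_series_single].
intros k; unfold lp_terms, unit_seq; destruct (Nat.eqb_spec k i) as [->|].
- now rewrite abs_one, rpow_base_1, Rmult_1_l.
- rewrite abs_zero, (rpow_npos 0); lra.
Qed.

Definition unit_vec (i : nat) : weighted_lp K hp hw :=
  exist (in_lp p w) (unit_seq i) (ex_intro _ _ (is_series_unit_seq i)).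

Lemma norm_unit_vec (i : nat) : norm (unit_vec i) = w i.
Proof.
change (rpow (Series (lp_terms p w (unit_seq i))) (/ p) = w i).
rewrite (is_series_unique _ _ (is_series_unit_seq i)), rpow_rpow, Rinv_r by lra.
apply rpow_1, Rlt_le, hw.
Qed.

Lemma iter_shift_unit_vec (i k : nat) :
  (k <= i)%nat -> Nat.iter k B (unit_vec i) = unit_vec (i - k).
Proof.
intros Hk; apply wlp_eq; intros j; rewrite seq_of_iter_shift.
change (unit_seq i (k + j) = unit_seq (i - k) j); unfold unit_seq.
destruct (Nat.eqb_spec (k + j) i), (Nat.eqb_spec j (i - k)); easy || lia.
Qed.

(** * Cesàro constants compared with the supremum of the weight averages *)

Lemma abs_cesaro_bound_iff (r C : R) :
  abs_cesaro_bound B r C <->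
  0 < C /\ forall x n,
    sum_n (fun k => rpow (norm (Nat.iter k B x)) r) n <= INR (S n) * C * rpow (norm x) r.
Proof.
unfold abs_cesaro_bound; split; intros [HC H]; split; try exact HC; intros x.
- intros n; rewrite Rmult_assoc; apply mean_le_iff.
  exact (proj1 (Sup_seq_le_iff _ _) (H x) n).
- apply Sup_seq_le_iff; intros n; apply (mean_le_iff n); rewrite <- Rmult_assoc; apply H.
Qed.

Lemma shift_abs_cesaro_bound (q a : R) :
  p <= q -> weight_cesaro_sup w q = Finite a -> abs_cesaro_bound B q a.
Proof.
intros Hq E; apply abs_cesaro_bound_iff; split.
- pose proof (weight_cesaro_sup_ge1 w hw q) as H; rewrite E in H; simpl in H; lra.
- intros x n; apply shift_cesaro_le; [exact Hq|rewrite E; apply Rbar_le_refl].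
Qed.

(** Test the bound on [unit_vec i] with [i >= n]: the iterates up to [n] have norms [w (i - k)], and
    dividing by [rpow (w i) r] gives the sums defining the supremum. *)
Lemma weight_cesaro_sup_le_bound (r C : R) :
  abs_cesaro_bound B r C -> Rbar_le (weight_cesaro_sup w r) C.
Proof.
rewrite abs_cesaro_bound_iff; intros [_ H]; apply weight_cesaro_sup_le_iff.
intros n i Hi; specialize (H (unit_vec i) n); rewrite norm_unit_vec in H.
apply Rmult_le_reg_l with (rpow (w i) r); [apply rpow_gt0, hw|].
rewrite (Rmult_comm (rpow (w i) r) (_ * C)).
eapply Rle_trans; [|exact H]; right.
rewrite <- sum_n_Rmult_l; apply sum_n_ext_loc; intros k Hk.
rewrite iter_shift_unit_vec, norm_unit_vec by lia.
rewrite Rmult_comm; now apply rpow_div.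
Qed.

Lemma weight_cesaro_sup_finite (r : R) :
  Rbar_lt (weight_cesaro_sup w r) p_infty -> exists a, weight_cesaro_sup w r = Finite a.
Proof.
pose proof (weight_cesaro_sup_ge1 w hw r) as H1.
destruct (weight_cesaro_sup w r) as [a| |]; [now exists a|easy|easy].
Qed.

End Shift.

Theorem theorem3p4
  (K : AbsRing) (hK : K = R_AbsRing \/ K = C_AbsRing)
  (p : R) (hp : 1 <= p)
  (w : nat -> R) (hw : forall k : nat, 0 < w k)
  (hb : Rbar_lt (Sup_seq (fun k : nat => Finite (w k / w (S k)))) p_infty) :
  let B : weighted_lp K hp hw -> weighted_lp K hp hw := backward_shift K hp hw hb in
  (forall q : R, p <= q ->
     Rbar_lt (weight_cesaro_sup w q) p_infty -> abs_cesaro_bounded B q) /\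
  (forall r : R, 0 < r ->
     abs_cesaro_bounded B r -> Rbar_lt (weight_cesaro_sup w r) p_infty) /\
  (forall q : R, p <= q ->
     (abs_cesaro_bounded B q <-> Rbar_lt (weight_cesaro_sup w q) p_infty) /\
     (abs_cesaro_bounded B q ->
        exists C : R, is_abs_cesaro_constant B q C /\
                      Finite C = weight_cesaro_sup w q)).

Proof.
intros B.
assert (bounded : forall q, p <= q ->
  Rbar_lt (weight_cesaro_sup w q) p_infty -> abs_cesaro_bounded B q).
{ intros q Hq Hfin; split; [apply backward_shift_is_linear|].
  destruct (weight_cesaro_sup_finite w hw q Hfin) as [a Ha]; exists a.
  now apply shift_abs_cesaro_bound. }
assert (finite : forall r, abs_cesaro_bounded B r ->
  Rbar_lt (weight_cesaro_sup w r) p_infty).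
{ intros r [_ [C HC]]; eapply Rbar_le_lt_trans;
    [exact (weight_cesaro_sup_le_bound _ _ _ _ _ _ _ _ HC)|exact I]. }
split; [exact bounded|split; [intros r _; apply finite|]].
intros q Hq; split; [split; [apply finite|now apply bounded]|].
intros HB; destruct (weight_cesaro_sup_finite w hw q (finite q HB)) as [a Ha].
(* The upper estimate makes [a] admissible; the unit vectors show that every admissible constant is
   at least [a]. *)
exists a; split; [split|now symmetry].
- now apply shift_abs_cesaro_bound.
- intros C' HC'; pose proof (weight_cesaro_sup_le_bound _ _ _ _ _ _ _ _ HC') as H.
  now rewrite Ha in H.
Qed.
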